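(* The shift space $\mathbb{Y}\subset\{0,1\}^\infty$ (defined in the context) is mixing, has the average shadowing property, positive topological entropy and a fully supported invariant measure.
   Context: For a finite set $\mathcal{A}$ with the discrete topology, $\mathcal{A}^\infty$ is the product space of sequences indexed by nonnegative integers, with shift $\sigma(\omega)_i=\omega_{i+1}$. A shift space is a nonempty closed $\sigma$-invariant subset, regarded as a dynamical system under $\sigma$. Construction of $\mathbb{Y}$. Let $1<s<t$ be integers. Let $\mathcal{G}^{(s,t)}$ be the directed labelled graph with labels in $\{0,\diamondsuit\}$, vertices $v_0,\dots,v_{t-s},w_0,\dots,w_{s-1}$ and edges: $e_i$ from $v_{i-1}$ to $v_i$ labelled $\diamondsuit$ ($1\le i\le t-s$); $e_i'$ from $w_{i-1}$ to $w_i$ labelled $0$ ($1\le i\le s-1$); $\hat e_1$ from $v_{t-s}$ to $w_0$ labelled $\diamondsuit$; $\hat e_2$ from $v_{t-s}$ to $w_1$ labelled $0$; $\hat e_3$ from $w_{s-1}$ to $v_0$ labelled $0$. Let $X_{(s,t)}\subset\{0,\diamondsuit\}^\infty$ be the set of label sequences of infinite paths on $\mathcal{G}^{(s,t)}$ (so its elements are concatenations of blocks of $s$ zeros separated by blocks of $t-s$ or $t-s+1$ symbols $\diamondsuit$). Put $$F^{(s,t)}=\{x\in\{0,1\}^\infty:\ \text{there exists } y\in X_{(s,t)}\text{ such that if } y_i=0\text{ then } x_i=0\}.$$ With $s_i=2^i$ and $t_i=10^i$, define $\mathbb{Y}=\bigcap_{i=1}^\infty F^{(s_i,t_i)}$.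 Properties. A system $(X,T)$ ($X$ compact metric with metric $\rho$, $T$ continuous) is mixing if for all nonempty open $U,V\subset X$ there is $N\ge0$ with $T^n(U)\cap V\neq\emptyset$ for all $n\ge N$. A sequence $\{x_n\}_{n=0}^\infty$ in $X$ is a $\delta$-average pseudoorbit if there is an integer $N_0>0$ such that $\frac1N\sum_{n=0}^{N-1}\rho(T(x_{n+k}),x_{n+k+1})<\delta$ for every $N>N_0$ and $k\ge0$. It is $\varepsilon$-shadowed in average by $x\in X$ if $\limsup_{N\to\infty}\frac1N\sum_{n=0}^{N-1}\rho(T^n(x),x_n)<\varepsilon$. $(X,T)$ has the average shadowing property if for every $\varepsilon>0$ there is $\delta>0$ such that every $\delta$-average pseudoorbit is $\varepsilon$-shadowed in average by some point of $X$. An invariant measure is a $\sigma$-invariant Borel probability measure; it is fully supported if every nonempty open subset of $\mathbb{Y}$ has positive measure. *)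

(* Defs.v *)
From HB Require Import structures.
From mathcomp Require Import all_boot all_order all_algebra.
From mathcomp Require Import finmap.
From mathcomp Require Import all_classical all_reals all_analysis.
Import Order.TTheory GRing.Theory Num.Theory.
Import numFieldNormedType.Exports.

Set Implicit Arguments.
Unset Strict Implicit.
Unset Printing Implicit Defensive.

Local Open Scope classical_set_scope.
Local Open Scope ring_scope.

(** * Topological dynamics on a subspace

   A system is given by a subset [Y] of a topological space [X] and a map
   [T : X -> X] with [T @` Y `<=` Y]. The space [Y] carries the subspace
   topology, so its open sets are the traces [Y `&` U] with [U] open in [X]. *)

Definition mixing (X : topologicalType) (Y : set X) (T : X -> X) : Prop :=
  forall U V : set X, open U -> open V ->
    Y `&` U !=set0 -> Y `&` V !=set0 ->
    exists N : nat, forall n : nat, (N <= n)%N ->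
      (iter n T @` (Y `&` U)) `&` (Y `&` V) !=set0.

(* [rho] is a metric on [Y] that induces the subspace topology; its values
   outside of [Y] are irrelevant. *)
Definition compatible_metric (R : realType) (X : topologicalType) (Y : set X)
    (rho : X -> X -> R) : Prop :=
  [/\ forall x y, Y x -> Y y -> 0 <= rho x y,
      forall x y, Y x -> Y y -> (rho x y = 0 <-> x = y),
      forall x y, Y x -> Y y -> rho x y = rho y x,
      forall x y z, Y x -> Y y -> Y z -> rho x z <= rho x y + rho y z &
      forall x, Y x -> forall A : set X,
        within Y (nbhs x) A <->
        exists2 e : R, 0 < e & forall y, Y y -> rho x y < e -> A y].

(* For N = 0 the value is 0; this is harmless, since only large N matter. *)
Definition average (R : realType) (u : nat -> R) (N : nat) : R :=
  (\sum_(0 <= n < N) u n) / N%:R.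

Definition average_pseudo_orbit (R : realType) (X : Type) (T : X -> X)
    (rho : X -> X -> R) (delta : R) (x : nat -> X) : Prop :=
  exists2 N0 : nat, (0 < N0)%N & forall N k : nat, (N0 < N)%N ->
    average (fun n => rho (T (x (n + k)%N)) (x (n + k).+1)) N < delta.

Definition shadowed_in_average (R : realType) (X : Type) (T : X -> X)
    (rho : X -> X -> R) (eps : R) (x : nat -> X) (z : X) : Prop :=
  (limn_esup (fun N => (average (fun n => rho (iter n T z) (x n)) N)%:E)
    < eps%:E)%E.

Definition average_shadowing (R : realType) (X : topologicalType) (Y : set X)
    (T : X -> X) (rho : X -> X -> R) : Prop :=
  forall eps : R, 0 < eps -> exists2 delta : R, 0 < delta &
    forall x : nat -> X, (forall n, Y (x n)) ->
      average_pseudo_orbit T rho delta x ->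
      exists2 z, Y z & shadowed_in_average T rho eps x z.

Definition separated (R : realType) (X : Type) (T : X -> X)
    (rho : X -> X -> R) (n : nat) (eps : R) (E : set X) : Prop :=
  forall x y, E x -> E y -> x <> y ->
    exists2 i : nat, (i < n)%N & eps < rho (iter i T x) (iter i T y).

(* (1/n) log s_n(eps), where s_n(eps) is the largest cardinality of an
   (n, eps)-separated subset of [Y]. The empty set contributes ln 0 = 0, which
   changes nothing when [Y] is nonempty. *)
Definition log_separated_rate (R : realType) (X : choiceType) (Y : set X)
    (T : X -> X) (rho : X -> X -> R) (eps : R) (n : nat) : \bar R :=
  ereal_sup [set (ln (#|` fset_set E|%:R : R) / n%:R)%:E | E in
    [set E : set X | [/\ finite_set E, E `<=` Y & separated T rho n eps E]]].

(* Bowen's definition; the limit as eps -> 0+ is a supremum because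
   the limsup is nonincreasing in eps. *)
Definition topological_entropy (R : realType) (X : topologicalType)
    (Y : set X) (T : X -> X) (rho : X -> X -> R) : \bar R :=
  ereal_sup [set limn_esup (log_separated_rate Y T rho eps) | eps in
    [set eps : R | 0 < eps]].

(** * Subshifts of {0,1}^oo

   [cantor_space] is [nat -> bool] with the product topology, [bool] being
   discrete; [false] stands for 0 and [true] for 1. *)

Definition left_shift (x : cantor_space) : cantor_space := fun i : nat => x i.+1.

Definition shift_space (Y : set cantor_space) : Prop :=
  [/\ Y !=set0, closed Y & left_shift @` Y `<=` Y].

Definition borel_cantor := g_sigma_algebraType (@open cantor_space).

(* A Borel probability measure on the closed set [Y], represented as a Borel
   probability measure on the whole space that gives [Y] full mass. *)
Definition invariant_measure (R : realType) (Y : set cantor_space)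
    (mu : probability borel_cantor R) : Prop :=
  mu Y = 1%E /\
  forall A : set borel_cantor, measurable A -> mu (left_shift @^-1` A) = mu A.

Definition fully_supported (R : realType) (Y : set cantor_space)
    (mu : probability borel_cantor R) : Prop :=
  forall U : set cantor_space, open U -> Y `&` U !=set0 ->
    (0 < mu (Y `&` U))%E.

(** * The shift space Y *)

Inductive label : Type := Zero | Diamond.

(* [v_ i] is v_i and [w_ i] is w_i. The vertices v_i with i > t - s and w_i
   with i >= s, which are not in the graph, have no incident edge below when
   1 < s < t, so they lie on no path. *)
Inductive vertex : Type := v_ of nat | w_ of nat.

Inductive edge (s t : nat) : vertex -> label -> vertex -> Prop :=
| edge_e i : (1 <= i <= t - s)%N -> edge s t (v_ i.-1) Diamond (v_ i)
| edge_e' i : (1 <= i <= s - 1)%N -> edge s t (w_ i.-1) Zero (w_ i)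
| edge_hat1 : edge s t (v_ (t - s)) Diamond (w_ 0)
| edge_hat2 : edge s t (v_ (t - s)) Zero (w_ 1)
| edge_hat3 : edge s t (w_ (s - 1)) Zero (v_ 0).

Definition label_sequences (s t : nat) : set (nat -> label) :=
  [set y | exists p : nat -> vertex, forall n, edge s t (p n) (y n) (p n.+1)].

Definition dominated (s t : nat) : set cantor_space :=
  [set x | exists2 y, label_sequences s t y &
    forall i : nat, y i = Zero -> x i = false].

Definition YY : set cantor_space :=
  \bigcap_(i in [set i : nat | (1 <= i)%N]) dominated (2 ^ i)%N (10 ^ i)%N.

(* Main.v *)
(** A path of the graph of level [i] is the same thing as a clock that counts up
   from [0] and returns to [0] from [t_i - 1] or from [t_i]; the label is a zero
   exactly while the clock is below [s_i]. So a point of [YY] is one that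
   vanishes where some clock of each level prescribes it. Two facts give
   everything. First, since [t_i] and [t_i + 1] are coprime, the clocks of the
   levels [i <= n] can be connected across any sufficiently long gap of zeros,
   so that pieces of points of [YY] can be spliced. Second, the levels [i > n]
   can be served by periodic clocks, at the price of erasing a set of positions
   of density at most [\sum_(i > n) 5^-i = 5^-n / 4].
   - Mixing and average shadowing splice pieces of the given points and then
     erase the high levels.
   - The points supported on the complement of the set erased for [n = 0] give
     entropy at least [3/4 ln 2].
   - Repeating a word with a period that is a power of [10] and then erasing
     gives a point of [YY] in which the word has positive lower density. A limit
     along an ultrafilter of weighted empirical measures of such points is a
     finitely additive invariant measure, which extends to a Borel measure by
     compactness and Carathéodory's theorem. *)
Require Import Defs.
From HB Require Import structures.
From mathcomp Require Import all_boot all_order all_algebra.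
From mathcomp Require Import finmap zify lra.
From mathcomp Require Import all_classical all_reals all_analysis.
Import Order.TTheory GRing.Theory Num.Theory.
Import numFieldNormedType.Exports.

Set Implicit Arguments.
Unset Strict Implicit.
Unset Printing Implicit Defensive.

Local Open Scope classical_set_scope.

(** * Diagonal limits along ultrafilters *)

Lemma ultra_fiber (I : Type) (T : finType) (F : set_system I) (f : I -> T) :
  UltraFilter F -> exists c, F [set i | f i = c].
Proof.
move=> UF; apply: contrapT => /forallNP nF.
have : \forall i \near F, forall c, f i <> c.
  apply: filter_forall => c.
  by have [/nF|] := in_ultra_setVsetC [set i | f i = c] UF.
by case/filter_ex => i /(_ (f i)); apply.
Qed.

(** An ultrafilter finer than the filter at infinity selects one value for each coordinate, and any
    finite number of these choices hold together at arbitrarily large indices. This is the only form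
    of compactness used for sequences of symbols and of phases. *)
Lemma sequence_cluster (T : finType) (u : nat -> nat -> T) :
  exists a : nat -> T, forall K m : nat, exists2 n : nat, (m <= n)%N &
    forall k, (k < K)%N -> u n k = a k.
Proof.
have [U [UU subU]] := ultraFilterLemma (eventually_filter : ProperFilter \oo).
have /choice[a aU] : forall k, exists c, U [set n | u n k = c].
  by move=> k; exact: ultra_fiber.
exists a => K m.
have agree : \forall n \near U, forall k : 'I_K, u n k = a k.
  by apply: filter_forall => k; exact: aU.
have large : U [set n | (m <= n)%N] by apply: subU; exists m.
have [n [agr mn]] := filter_ex (filterI agree large).
by exists n => // k kK; exact: (agr (Ordinal kK)).
Qed.

(** * Phases of the labelled graph *)

Definition step (t a b : nat) : bool :=
  [&& a <= t, b <= t & (b == a.+1) || (b == 0) && (t <= a.+1)]%N.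

Definition counter (t : nat) (a : nat -> nat) : Prop :=
  forall n, step t (a n) (a n.+1).

(* The phase of a vertex is the number of steps since the last visit of [w_ 1].
   The edge into [w_ 1] carries the first zero of a block, so an edge is labelled
   [Zero] exactly when the phase of its target is less than [s]. *)
Definition phase (s t : nat) (v : vertex) : nat :=
  match v with v_ i => i + s.-1 | w_ 0 => t | w_ j.+1 => j end.

(** The inverse of [phase] on the phases from [0] to [t]. *)
Definition vertex_of_phase (s t c : nat) : vertex :=
  if c < s.-1 then w_ c.+1 else if c < t then v_ (c - s.-1) else w_ 0.

Lemma edge_phase (s t : nat) (v w : vertex) (l : label) : (1 < s < t)%N ->
  edge s t v l w ->
  step t (phase s t v) (phase s t w) /\ ((phase s t w < s)%N -> l = Zero).
Proof.
move=> st [i|i||| ]; rewrite /step.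
- by case: i => //= i i1; split; [lia|move=> h; exfalso; lia].
- by case: i => [|[|i]] //= i1; split=> //; lia.
- by split=> /= [|h]; [lia|exfalso; lia].
- by split=> //=; lia.
- by case: s st => [|[|s]] //= st; split=> //; lia.
Qed.

Lemma step_edge (s t a b : nat) : (1 < s < t)%N -> step t a b ->
  edge s t (vertex_of_phase s t a) (if (b < s)%N then Zero else Diamond)
    (vertex_of_phase s t b).
Proof.
move=> st /and3P[at_ bt /orP[/eqP b_a|/andP[/eqP b0 ta]]]; rewrite /vertex_of_phase.
- subst b; case: (ltnP a.+1 s.-1) => a1.
  + rewrite !ifT; try lia.
    by apply: (@edge_e' s t a.+2); lia.
  + case: (ltnP a.+1 t) => a2; last first.
      have -> : (a < s.-1)%N = false by lia.
      have -> : (a.+1 < s)%N = false by lia.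
      rewrite bt.
      by rewrite (_ : a - s.-1 = t - s)%N; [exact: edge_hat1|lia].
    case: (ltnP a s.-1) => a3.
      have -> : (a.+1 < s)%N by lia.
      rewrite (_ : a.+1 = s - 1)%N; last lia.
      by rewrite (_ : s - 1 - s.-1 = 0)%N; [exact: edge_hat3|lia].
    have -> : (a.+1 < s)%N = false by lia.
    have -> : (a < t)%N by lia.
    rewrite (_ : (a - s.-1) = (a.+1 - s.-1).-1)%N; last lia.
    by apply: edge_e; lia.
- subst b; rewrite [in X in edge _ _ _ X](_ : (0 < s)%N = true); last lia.
  rewrite [in X in edge _ _ _ _ X](_ : (0 < s.-1)%N = true); last lia.
  case: (ltnP a t) => a2.
    rewrite ifF; last lia.
    by rewrite (_ : a - s.-1 = t - s)%N; [exact: edge_hat2|lia].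
  rewrite ifF; last lia.
  by apply: (@edge_e' s t 1); lia.
Qed.

Lemma dominatedE (s t : nat) (x : cantor_space) : (1 < s < t)%N ->
  dominated s t x <->
  exists2 a, counter t a & forall n, (a n < s)%N -> x n = false.
Proof.
move=> st; split.
  (* The label [y n] belongs to the edge from [p n] to [p n.+1], so the clock at time [n] reads the
     target. *)
  move=> [y [p py] xy]; exists (fun n => phase s t (p n.+1)).
    by move=> n; have [] := edge_phase st (py n.+1).
  by move=> n /(edge_phase st (py n)).2; exact: xy.
move=> [a ca xa].
(* A path also needs a source for its first edge, so the clock is extended by one step into the
   past; [t] is a possible predecessor of phase [0]. *)
pose b n := if n is m.+1 then a m else if a 0 is c.+1 then c else t.
have cb : counter t b.
  move=> [|n]; last exact: ca.
  by have := ca 0; rewrite /b /step; case: (a 0) => [|c]; lia.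
exists (fun n => if (a n < s)%N then Zero else Diamond).
  by exists (fun n => vertex_of_phase s t (b n)) => n; exact: step_edge.
by move=> i; case: ifP => // /xa.
Qed.

(** * Connecting prescribed phases *)

Definition reach (t n p q : nat) : Prop :=
  exists f : nat -> nat, [/\ f 0 = p, f n = q &
    forall k, (k < n)%N -> step t (f k) (f k.+1)].

Lemma reach_cat (t n m p q r : nat) :
  reach t n p q -> reach t m q r -> reach t (n + m) p r.
Proof.
move=> [f [f0 fn fS]] [g [g0 gm gS]].
exists (fun k => if (k <= n)%N then f k else g (k - n)%N); split => //.
  case: (posnP m) => [m0|m0]; last by rewrite ifF ?addKn//; lia.
  by rewrite m0 addn0 leqnn fn -gm m0.
move=> k knm; case: (ltnP k n) => kn; first by rewrite ltnW//; exact: fS.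
have [->|nk] := eqVneq k n.
  by rewrite leqnn fn -g0 subSnn; apply: gS; lia.
rewrite leqNgt; have -> : (n < k)%N by lia.
by rewrite subSn; [apply: gS|]; lia.
Qed.

Lemma reach_up (t p n : nat) : (p + n <= t)%N -> reach t n p (p + n).
Proof.
move=> pnt; exists (fun k => p + k)%N; split => //; first by rewrite addn0.
by move=> k kn; rewrite /step; lia.
Qed.

Lemma reach_return (t p : nat) : (t <= p.+1)%N -> (p <= t)%N -> reach t 1 p 0.
Proof.
by move=> tp pt; exists (fun k => if k is 0 then p else 0); split => // -[|//] _;
  rewrite /step; lia.
Qed.

Lemma reach_loops (t n p m : nat) : reach t n p p -> reach t (m * n) p p.
Proof.
move=> r; elim: m => [|m IH]; last by rewrite mulSn; exact: reach_cat r IH.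
by rewrite mul0n; exists (fun=> p); split.
Qed.

(* The loops at phase 0 have the coprime lengths [t] and [t.+1]. *)
Lemma reach_all (t p q n : nat) : (0 < t)%N -> (p <= t)%N -> (q <= t)%N ->
  (t.+1 ^ 2 <= n)%N -> reach t n p q.
Proof.
move=> t0 pt qt tn.
(* The route climbs from [p] to [t], returns to [0], loops there for [m] steps and climbs to [q]. As
   [(t + 1)^2 = t^2 + (t + 1) + t], at least [t^2] steps remain for the loops. *)
pose m := (n - (t - p + 1) - q)%N.
have tm : (t * t <= m)%N by rewrite /m; nia.
(* Of the [m %/ t] loops, [m %% t] are lengthened from [t] to [t.+1]; there are enough of them
   because [m >= t^2]. *)
have dm : (m %% t <= m %/ t)%N.
  by rewrite (leq_trans (ltnW (ltn_pmod _ t0)))// leq_divRL.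
have -> : n = (t - p + 1 +
    (((m %/ t - m %% t) * t + (m %% t) * t.+1) + q))%N.
  have := divn_eq m t; rewrite {2}/m; nia.
apply: (reach_cat (q := 0)).
  apply: (reach_cat (q := t)); last by apply: reach_return; lia.
  by have := @reach_up t p (t - p); rewrite subnKC//; apply.
apply: (reach_cat (q := 0)); last by have := @reach_up t 0 q; apply.
apply: reach_cat; apply: reach_loops.
  rewrite -[X in reach _ X](subnK t0); apply: (reach_cat (q := (t - 1)%N)).
    by have := @reach_up t 0 (t - 1); apply; lia.
  by apply: reach_return; lia.
rewrite -[X in reach _ X]addn1; apply: (reach_cat (q := t)).
  by have := @reach_up t 0 t; apply.
by apply: reach_return; lia.
Qed.

(** Block [k] follows [c k] for [L] steps and spends its other [G] steps on a path from [c k L] to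
    [c k.+1 0], which [reach_all] provides. *)
Lemma counter_splice (t L G : nat) (c : nat -> nat -> nat) :
  (0 < t)%N -> (t.+1 ^ 2 <= G)%N -> (forall k, counter t (c k)) ->
  exists2 d, counter t d &
    forall k j, (j <= L)%N -> d (k * (L + G) + j)%N = c k j.
Proof.
move=> t0 tG cc.
have c_le k j : (c k j <= t)%N by have /and3P[] := cc k j.
have /choice[f fP] : forall k, exists f, [/\ f 0 = c k L, f G = c k.+1 0 &
    forall j, (j < G)%N -> step t (f j) (f j.+1)].
  by move=> k; exact: reach_all.
have G0 : (0 < G)%N by apply: leq_trans tG.
pose P := (L + G)%N; have P0 : (0 < P)%N by rewrite /P; lia.
pose e k j := if (j <= L)%N then c k j else f k (j - L)%N.
exists (fun n => e (n %/ P) (n %% P)); last first.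
  move=> k j jL; have jP : (j < P)%N by rewrite /P; lia.
  by rewrite divnMDl// divn_small// addn0 modnMDl modn_small// /e jL.
move=> n; set k := (n %/ P)%N; set j := (n %% P)%N.
have jP : (j < P)%N by rewrite ltn_pmod.
have e_step i : (i < P)%N -> step t (e k i) (if (i.+1 == P) then e k.+1 0 else e k i.+1).
  move=> iP; rewrite /e; have [f0 fG fS] := fP k.
  case: (ltnP i L) => iL.
    by rewrite ltnW// ifF; [exact: cc|rewrite /P; lia].
  have -> : (if (i <= L)%N then c k i else f k (i - L)%N) = f k (i - L)%N.
    by case: (leqP i L) => // iL'; rewrite (_ : i = L) ?subnn ?f0//; lia.
  have -> : (if i.+1 == P then
      (if (0 <= L)%N then c k.+1 0 else f k.+1 (0 - L)%N)
      else f k (i.+1 - L)%N) = f k (i - L).+1.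
    case: eqP => iP'; last by congr f; lia.
    by rewrite /= -fG; congr f; rewrite /P in iP'; lia.
  by apply: fS; rewrite /P in iP; lia.
have := e_step j jP.
rewrite (divn_eq n P) -/k -/j -addnS.
case: eqP => jP'.
  by rewrite jP' -mulSnr modnMl mulnK.
have {}jP' : (j.+1 < P)%N by lia.
by rewrite divnMDl// divn_small// addn0 modnMDl modn_small.
Qed.

(** * Splicing and erasing *)

Lemma level_ok (i : nat) : (1 <= i)%N -> (1 < 2 ^ i < 10 ^ i)%N.
Proof.
by move=> i0; rewrite -[1%N](expn0 2) ltn_exp2l// i0/= ltn_exp2r.
Qed.

Definition splice (L P : nat) (x : nat -> cantor_space) : cantor_space :=
  fun m => (m %% P < L)%N && x (m %/ P)%N (m %% P)%N.

(* The zeros of the level [i > n] are put at the end of each period, so that the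
   density bound below holds on every initial segment, without an error term. *)
Definition hole (n : nat) (r : nat -> nat) (k : nat) : Prop :=
  exists2 i, (n < i)%N & (10 ^ i - 2 ^ i <= (k + r i) %% 10 ^ i)%N.

Definition erase (n : nat) (r : nat -> nat) (z : cantor_space) : cantor_space :=
  fun k => z k && ~~ `[< hole n r k >].

Lemma splice_dominated (i L G : nat) (x : nat -> cantor_space) : (1 <= i)%N ->
  ((10 ^ i).+1 ^ 2 <= G)%N -> (forall k, dominated (2 ^ i) (10 ^ i) (x k)) ->
  dominated (2 ^ i) (10 ^ i) (splice L (L + G) x).
Proof.
move=> i1 iG xd; have st := level_ok i1.
have t0 : (0 < 10 ^ i)%N by rewrite expn_gt0.
have /choice[c cP] : forall k, exists c, counter (10 ^ i) c /\
    forall n, (c n < 2 ^ i)%N -> x k n = false.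
  by move=> k; have /(dominatedE _ st)[a ? ?] := xd k; exists a.
have [d cd dc] := @counter_splice (10 ^ i) L G c t0 iG (fun k => (cP k).1).
apply/(dominatedE _ st); exists d => // n dn; rewrite /splice.
case: ltnP => // nL /=.
by apply: (cP _).2; rewrite -dc ?(ltnW nL)// -divn_eq.
Qed.

Lemma periodic_counter (t m : nat) : (0 < t)%N ->
  counter t (fun k => (k + m) %% t)%N.
Proof.
move=> t0 n; rewrite /step.
have r1 : ((n + m) %% t < t)%N by rewrite ltn_pmod.
have r2 : ((n.+1 + m) %% t < t)%N by rewrite ltn_pmod.
have e1 := divn_eq (n + m) t; have e2 := divn_eq (n.+1 + m) t.
have -> : ((n.+1 + m) %% t = ((n + m) %% t).+1 %% t)%N.
  by rewrite addSn -addn1 -modnDml addn1.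
case: (ltnP ((n + m) %% t).+1 t) => h.
  by rewrite (modn_small h); lia.
rewrite (_ : ((n + m) %% t).+1 = t); last lia.
by rewrite modnn; lia.
Qed.

(** Erasing only turns ones into zeros, so the clocks of the levels up to [n] still serve. A level
    above [n] gets a periodic clock, whose zeros are its holes. *)
Lemma erase_YY (n : nat) (r : nat -> nat) (z : cantor_space) :
  (forall i, (1 <= i <= n)%N -> dominated (2 ^ i) (10 ^ i) z) ->
  YY (erase n r z).
Proof.
move=> zd i /= i1; have st := level_ok i1.
case: (leqP i n) => ni.
  have /zd[y yl yz] : (1 <= i <= n)%N by rewrite i1.
  by exists y => // j /yz; rewrite /erase => ->.
apply/(dominatedE _ st).
(* The additional offset [2 ^ i] carries the last [2 ^ i] residues of a period to the phases below
   [2 ^ i]. *)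
exists (fun k => (k + (r i + 2 ^ i)) %% 10 ^ i)%N.
  by apply: periodic_counter; rewrite expn_gt0.
move=> k kh; rewrite /erase.
suff -> : `[< hole n r k >] by rewrite andbF.
apply/asboolP; exists i => //; move: kh; rewrite addnA -modnDml.
set q := ((k + r i) %% 10 ^ i)%N.
case: (leqP (10 ^ i - 2 ^ i) q) => // qs.
by rewrite modn_small; lia.
Qed.

Lemma count_mod (t s N : nat) : (0 < t)%N -> (s <= t)%N ->
  (t * \sum_(k < N) (t - s <= k %% t)%N <= N * s)%N.
Proof.
move=> t0 st.
(* Each full period contributes [s]. The marked residues come last, so an incomplete period
   contributes at most its proportional share. *)
have -> : (\sum_(k < N) (t - s <= k %% t)%N = N %/ t * s + (N %% t - (t - s)))%N.
  elim: N => [|N IH]; first by rewrite big_ord0 div0n mod0n.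
  rewrite big_ord_recr /= IH.
  have r1 : (N %% t < t)%N by rewrite ltn_pmod.
  have -> : N.+1 = (N %/ t * t + (N %% t).+1)%N by rewrite addnS -divn_eq.
  have [h|h] := ltnP (N %% t).+1 t.
    by rewrite divnMDl// (divn_small h) addn0 modnMDl (modn_small h); lia.
  have {}h : (N %% t).+1 = t by lia.
  by rewrite h -mulSnr mulnK// modnMl; nia.
have r1 : (N %% t < t)%N by rewrite ltn_pmod.
rewrite {3}(divn_eq N t); nia.
Qed.

(** A union bound over the levels [i > n]: level [i] has density at most [5^-i], and these densities
    add up to [5^-n / 4]. *)
Lemma hole_density (n N : nat) :
  (4 * 5 ^ n * \sum_(k < N) `[< hole n (fun=> 0) k >] <= N)%N.
Proof.
pose c j := (\sum_(k < N) (10 ^ (n.+1 + j) - 2 ^ (n.+1 + j) <= k %% 10 ^ (n.+1 + j)))%N.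
have c_le j : (5 ^ (n.+1 + j) * c j <= N)%N.
  have t0 : (0 < 10 ^ (n.+1 + j))%N by rewrite expn_gt0.
  have := @count_mod (10 ^ (n.+1 + j)) (2 ^ (n.+1 + j)) N t0.
  rewrite leq_exp2r// => /(_ isT); rewrite -/(c j).
  rewrite (_ : 10 = 5 * 2)%N// expnMn mulnAC -mulnA.
  by rewrite mulnA leq_pmul2r ?expn_gt0.
have hole_le : (\sum_(k < N) `[< hole n (fun=> 0) k >] <= \sum_(j < N) c j)%N.
  rewrite exchange_big /=; apply: leq_sum => k _.
  case: asboolP => // -[i ni]; rewrite addn0.
  (* Finitely many levels suffice: when [i - n.+1 >= N], the first hole of level [i], at
     [10 ^ i - 2 ^ i], lies beyond [N]. *)
  case: (ltnP (i - n.+1) N) => iN ki.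
    rewrite (bigD1 (Ordinal iN)) //= (_ : n.+1 + (i - n.+1) = i)%N; last lia.
    by rewrite ki.
  have N_lt : (N < 10 ^ i - 2 ^ i)%N.
    have : (2 * 2 ^ i <= 10 ^ i)%N.
      rewrite (_ : 10 = 2 * 5)%N// expnMn mulnC leq_pmul2l ?expn_gt0//.
      case: i ni {iN ki} => // i _; rewrite expnS.
      have : (0 < 5 ^ i)%N by rewrite expn_gt0.
      lia.
    by have := @ltn_expl 2 i isT; lia.
  have kN := ltn_ord k.
  have k10 : (k < 10 ^ i)%N by lia.
  by rewrite modn_small// in ki; lia.
(* The partial geometric sum [5^-n (1 - 5^-m) / 4] with denominators cleared. *)
have main m : (4 * 5 ^ n * 5 ^ m * \sum_(j < m) c j <= N * (5 ^ m - 1))%N.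
  elim: m => [|m IH]; first by rewrite big_ord0 muln0.
  rewrite big_ord_recr /=.
  have := c_le m; rewrite addSn expnS expnD => cm.
  have p5 : (0 < 5 ^ m)%N by rewrite expn_gt0.
  rewrite expnS; set S := (\sum_(j < m) c j)%N in IH *.
  move: cm IH p5; move: (5 ^ m)%N (5 ^ n)%N (c m) => A B C cm IH p5.
  nia.
have := main N; have p5 : (0 < 5 ^ N)%N by rewrite expn_gt0.
move: hole_le p5; move: (5 ^ N)%N (5 ^ n)%N (\sum_(j < N) c j)%N => A B C h p5 h2.
have : (A * (4 * B * C) <= A * N)%N by nia.
rewrite leq_pmul2l// => h3; apply: leq_trans h3.
by rewrite leq_mul2l h orbT.
Qed.

(** * The shift space and mixing *)

Definition agree (K : nat) (x y : cantor_space) : Prop :=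
  forall k, (k < K)%N -> y k = x k.

Lemma agree_le (K M : nat) (x y : cantor_space) : (K <= M)%N ->
  agree M x y -> agree K x y.
Proof. by move=> KM xy k kK; apply: xy; exact: leq_trans KM. Qed.

Lemma nbhs_cylinder (x : cantor_space) (A : set cantor_space) :
  nbhs x A <-> exists K, agree K x `<=` A.
Proof.
split; last first.
  move=> [K KA].
  have : nbhs x (fun y => forall k : 'I_K, y k = x k).
    apply: (@filter_forall _ _
      (fun (k : 'I_K) (y : cantor_space) => y k = x k) (nbhs x)) => k.
    have := @proj_continuous nat (fun=> bool) k x.
    by move=> /(_ [set x k]); apply; exact: (@discrete_set1 bool (x k)).
  by apply: filterS => y xy; apply: KA => k kK; exact: (xy (Ordinal kK)).
pose F := filter_from setT (fun K => agree K x).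
have FF : Filter F.
  apply: filter_from_filter; first by exists 0.
  move=> i j _ _; exists (maxn i j) => // y xy.
  by split; apply: agree_le xy; rewrite ?leq_maxl ?leq_maxr.
suff Fx : F --> x by move=> /Fx[K _ KA]; exists K.
apply/cvg_sup => i; apply/cvg_image => //.
  by rewrite eqEsubset; split=> // b _; exists (fun=> b).
move=> B /nbhs_singleton Bx.
exists (proj i @^-1` B); first by exists i.+1 => // y xy; rewrite /= /proj xy.
by rewrite image_preimage// eqEsubset; split=> // b _; exists (fun=> b).
Qed.

Lemma open_cylinder (U : set cantor_space) (x : cantor_space) :
  open U -> U x -> exists K, agree K x `<=` U.
Proof. by move=> oU Ux; apply/nbhs_cylinder/open_nbhs_nbhs. Qed.

Lemma closed_cylinder (A : set cantor_space) :
  (forall x, (forall K, exists2 y, A y & agree K x y) -> A x) -> closed A.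
Proof.
move=> Acl x clx; apply: Acl => K.
have [|y [Ay xy]] := clx (agree K x); last by exists y.
by apply/nbhs_cylinder; exists K.
Qed.

Lemma iter_left_shift (n k : nat) (x : cantor_space) :
  iter n left_shift x k = x (k + n)%N.
Proof.
elim: n k => [|n IH] k; first by rewrite addn0.
by rewrite iterS /left_shift IH addnS.
Qed.

(** The clocks of approximating points take values in a finite set, so they cluster at a clock, and
    this one serves the limit point. *)
Lemma dominated_closed (s t : nat) : (1 < s < t)%N -> closed (dominated s t).
Proof.
move=> st; apply: closed_cylinder => x xcl.
have /choice[a aP] : forall K, exists a, counter t a /\
    forall k, (k < K)%N -> (a k < s)%N -> x k = false.
  move=> K; have [y /(dominatedE _ st)[a ca ya] xy] := xcl K.
  by exists a; split=> // k kK /ya; rewrite xy.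
have [b bP] := sequence_cluster (fun n k => inord (a n k) : 'I_t.+1).
have b_approx K : exists2 n, (K <= n)%N & forall k, (k < K)%N -> a n k = b k.
  have [n Kn ab] := bP K K; exists n => // k /ab <-.
  by rewrite inordK// ltnS; have /and3P[] := (aP n).1 k.
apply/(dominatedE _ st); exists (fun n => b n : nat) => n.
  have [m mn ab] := b_approx n.+2.
  by rewrite -!ab//; exact: (aP m).1.
have [m mn ab] := b_approx n.+1.
by rewrite -ab//; exact: (aP m).2.
Qed.

Lemma dominated_shift (s t : nat) (x : cantor_space) : (1 < s < t)%N ->
  dominated s t x -> dominated s t (left_shift x).
Proof.
move=> st /(dominatedE _ st)[a ca xa]; apply/(dominatedE _ st).
by exists (fun n => a n.+1) => n; [exact: ca|exact: xa].
Qed.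

Lemma splice_YY (n L G : nat) (r : nat -> nat) (x : nat -> cantor_space) :
  ((10 ^ n).+1 ^ 2 <= G)%N -> (forall k, YY (x k)) ->
  YY (erase n r (splice L (L + G) x)).
Proof.
move=> nG Yx; apply: erase_YY => i /andP[i1 ni].
apply: splice_dominated => // [|k]; last exact: Yx.
by apply: leq_trans nG; rewrite leq_exp2r// ltnS leq_exp2l.
Qed.

Lemma YY_shift (x : cantor_space) (n : nat) : YY x -> YY (iter n left_shift x).
Proof.
move=> Yx; elim: n => //= n IH i i1.
by apply: dominated_shift; [exact: level_ok|exact: IH].
Qed.

Lemma YY_closed : closed YY.
Proof.
by apply: closed_bigI => i i1; apply: dominated_closed; exact: level_ok.
Qed.

Lemma shift_space_YY : shift_space YY.
Proof.
split; last 2 first.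
- exact: YY_closed.
- by move=> _ [x Yx <-]; exact: (@YY_shift x 1).
exists (erase 0 (fun=> 0) (fun=> false)).
by apply: erase_YY => i; case: i.
Qed.

(* With [p = n %% t], the shift [0] works unless the window of length [l] at
   [p] meets the marker at the end of the period; the shift [l + s] then moves
   that window past the end of the period. *)
Lemma avoid_two_windows (s t l n : nat) : (2 * (l + s) <= t)%N ->
  exists r, forall k, (k < l)%N ->
    ((k + r) %% t < t - s)%N /\ ((n + k + r) %% t < t - s)%N.
Proof.
move=> lst; case: (leqP ((n %% t) + l) (t - s)) => h.
  exists 0 => k kl; rewrite !addn0 -modnDml.
  by split; rewrite modn_small; lia.
exists (l + s)%N => k kl; have t0 : (0 < t)%N by lia.
have pt : (n %% t < t)%N by rewrite ltn_pmod.
rewrite -addnA -(modnDml n).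
have -> : (n %% t + (k + (l + s)) = 1 * t + (n %% t + (k + (l + s)) - t))%N by lia.
by split; rewrite ?modnMDl modn_small; lia.
Qed.

Lemma mixing_YY : mixing YY left_shift.
Proof.
move=> U V oU oV [x [Yx Ux]] [y [Yy Vy]].
have [K1 xU] := open_cylinder oU Ux.
have [K2 yV] := open_cylinder oV Vy.
(* [l] bounds the window lengths and is also the last level handled by splicing. For [i > l] this
   gives [2 (l + 2^i) <= 10^i], so each higher level can avoid both windows. *)
pose l := maxn K1 K2; pose G := ((10 ^ l).+1 ^ 2)%N.
exists (l + G)%N => n nlG.
have /choice[r rP] : forall i, exists r, (l < i)%N -> forall k, (k < l)%N ->
    ((k + r) %% 10 ^ i < 10 ^ i - 2 ^ i)%N /\
    ((n + k + r) %% 10 ^ i < 10 ^ i - 2 ^ i)%N.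
  move=> i; case: (ltnP l i) => li; last by exists 0.
  have [|r rP] := @avoid_two_windows (2 ^ i) (10 ^ i) l n; last by exists r.
  rewrite (_ : 10 = 2 * 5)%N// expnMn.
  have : (4 <= 5 ^ i)%N by case: i li => // i _; rewrite expnS; have := expn_gt0 5 i; lia.
  by have := @ltn_expl 2 i isT; nia.
have not_hole m : (exists2 k, (k < l)%N & m = k \/ m = (n + k)%N) ->
    `[< hole l r m >] = false.
  move=> [k kl mk]; apply/asboolP => -[i li].
  by have [h1 h2] := rP i li k kl; case: mk => ->; rewrite leqNgt ?h1 ?h2.
(* With blocks of length [n], the first copy of [y] starts exactly at time [n]. *)
pose X k := if k is 0 then x else y.
pose z := erase l r (splice (n - G) n X).
have Yz : YY z.
  rewrite /z -[in X in splice _ X](@subnK G n); last lia.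
  by apply: splice_YY => // -[].
exists (iter n left_shift z); split; last split.
- exists z => //; split => //; apply: xU => k kK.
  have kl : (k < l)%N by apply: leq_trans kK _; exact: leq_maxl.
  rewrite /z /erase not_hole ?andbT; last by exists k => //; left.
  by rewrite /splice modn_small ?divn_small/=; [case: ltnP|..]; lia.
- exact: YY_shift.
- apply: yV => k kK.
  have kl : (k < l)%N by apply: leq_trans kK _; exact: leq_maxr.
  rewrite iter_left_shift addnC /z /erase not_hole ?andbT; last first.
    by exists k => //; right.
  have -> : (n + k = 1 * n + k)%N by lia.
  rewrite /splice modnMDl divnMDl ?modn_small ?divn_small; try lia.
  by case: ltnP => //; lia.
Qed.

(** * Compatible metrics *)

Local Open Scope ring_scope.

Lemma YY_cluster (u : nat -> cantor_space) : (forall n, YY (u n)) ->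
  exists2 x, YY x &
    forall K m : nat, exists2 n, (m <= n)%N & agree K x (u n).
Proof.
move=> Yu; have [x xP] := sequence_cluster (fun n k => u n k).
exists x => //.
move: YY_closed; apply => B /nbhs_cylinder[K KB].
by have [n _ xn] := xP K 0; exists (u n); split => //; exact: KB.
Qed.

Section compatible.
Context (R : realType) (rho : cantor_space -> cantor_space -> R).
Context (rhoP : compatible_metric YY rho).

Lemma rho_small_at (x : cantor_space) (e : R) : YY x -> 0 < e ->
  exists K, forall y, YY y -> agree K x y -> rho x y < e.
Proof.
move=> Yx e0; have [_ _ _ _ rho_nbhs] := rhoP.
have : within YY (nbhs x) [set y | rho x y < e] by apply/(rho_nbhs x Yx); exists e.
by move=> /nbhs_cylinder[K KA]; exists K => y Yy /KA; apply.
Qed.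

Lemma agree_at (x : cantor_space) (K : nat) : YY x ->
  exists2 e : R, 0 < e & forall y, YY y -> rho x y < e -> agree K x y.
Proof.
move=> Yx; have [_ _ _ _ rho_nbhs] := rhoP.
apply/(rho_nbhs x Yx (agree K x)).
by apply: filterS (_ : nbhs x (agree K x)) => // ; apply/nbhs_cylinder; exists K.
Qed.

(** By compactness: pairs agreeing on ever longer prefixes while at distance at least [e] would
    cluster at a point, and both members of some pair would be within [e / 2] of it. *)
Lemma rho_small (e : R) : 0 < e ->
  exists K, forall x y, YY x -> YY y -> agree K x y -> rho x y < e.
Proof.
move=> e0; apply: contrapT => /forallNP bad.
have [_ _ rhoC rhoD _] := rhoP.
have /choice[p pP] : forall K, exists p : cantor_space * cantor_space,
    [/\ YY p.1, YY p.2, agree K p.1 p.2 & e <= rho p.1 p.2].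
  move=> K; have /existsNP[x /existsNP[y]] := bad K.
  move=> /not_implyP[Yx /not_implyP[Yy /not_implyP[xy /negP]]].
  by rewrite -leNgt => exy; exists (x, y).
have [|x Yx xP] := @YY_cluster (fun n => (p n).1); first by move=> n; case: (pP n).
have [K KP] := @rho_small_at x (e / 2) Yx (divr_gt0 e0 (ltr0n _ 2)).
have [n Kn xn] := xP K K.
have [Y1 Y2 p12 ep] := pP n.
have h1 := KP _ Y1 xn.
have h2 : rho x (p n).2 < e / 2.
  apply: KP => // k kK; rewrite -xn//; apply: p12.
  exact: leq_trans Kn.
have := rhoD _ _ _ Y1 Yx Y2; rewrite (rhoC _ _ Y1 Yx); lra.
Qed.

(** The converse uniformity, by the same argument: pairs ever closer for [rho] cluster at a point
    near which all points share its first [K] symbols. *)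
Lemma rho_agree (K : nat) :
  exists2 e : R, 0 < e & forall x y, YY x -> YY y -> rho x y < e -> agree K x y.
Proof.
apply: contrapT => bad; have [_ _ rhoC rhoD _] := rhoP.
have /choice[p pP] : forall n : nat, exists p : cantor_space * cantor_space,
    [/\ YY p.1, YY p.2, ~ agree K p.1 p.2 & rho p.1 p.2 < n.+1%:R^-1].
  move=> n; apply: contrapT => /forallNP nop; apply: bad.
  exists n.+1%:R^-1; first by rewrite invr_gt0.
  move=> x y Yx Yy xy; apply: contrapT => nxy.
  by apply: (nop (x, y)).
have [|x Yx xP] := @YY_cluster (fun n => (p n).1); first by move=> n; case: (pP n).
have [e e0 eP] := agree_at K Yx.
have e20 : 0 < e / 2 by rewrite divr_gt0.
have [M MP] := rho_small_at Yx e20.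
have [m m_small] : exists m, forall n, (m <= n)%N -> n.+1%:R^-1 < e / 2.
  have [m _ mP] := near_infty_natSinv_lt (PosNum e20).
  by exists m => n mn; exact: (mP n mn).
have [n mn xn] := xP (maxn K M) m.
have [Y1 Y2 p12 ep] := pP n; apply: p12 => k kK.
have xn1 : agree K x (p n).1 by apply: agree_le xn; exact: leq_maxl.
rewrite (xn1 k kK); apply: (eP _ Y2) => //.
have := rhoD _ _ _ Yx Y1 Y2.
move: ep (m_small n mn); set q := n.+1%:R^-1.
have : rho x (p n).1 < e / 2 by apply: MP => //; apply: agree_le xn; exact: leq_maxr.
lra.
Qed.

Lemma rho_bounded :
  exists2 B : R, 0 < B & forall x y, YY x -> YY y -> rho x y <= B.
Proof.
have [rho_ge0 _ rhoC rhoD _] := rhoP; have [ [p Yp] _ _] := shift_space_YY.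
suff [B BP] : exists B : R, forall x, YY x -> rho p x <= B.
  have B0 : 0 <= B by apply: le_trans (BP p Yp); exact: rho_ge0.
  exists (B + B + 1); first by lra.
  move=> x y Yx Yy; have := rhoD _ _ _ Yx Yp Yy.
  by rewrite (rhoC x p)//; have := BP x Yx; have := BP y Yy; lra.
apply: contrapT => /forallNP bad.
have /choice[u uP] : forall n : nat, exists u, YY u /\ n%:R < rho p u.
  move=> n; have /existsNP[x /not_implyP[Yx /negP]] := bad n%:R.
  by rewrite -ltNge => h; exists x.
have [|x Yx xP] := @YY_cluster u; first by move=> n; case: (uP n).
have [M MP] := rho_small_at Yx ltr01.
have [n mn xn] := xP M (Num.bound (rho p x + 1)).
have [Yu un] := uP n.
have := rhoD _ _ _ Yp Yx Yu; have := MP _ Yu xn.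
have : rho p x + 1 < n%:R.
  apply: lt_le_trans (_ : (Num.bound (rho p x + 1))%:R <= _); last by rewrite ler_nat.
  by apply: archi_boundP; rewrite addr_ge0// rho_ge0.
lra.
Qed.

End compatible.

(** * Average shadowing *)

Lemma sum_shift (f : nat -> nat) (N j : nat) :
  (\sum_(k < N) f (k + j) <= \sum_(k < N + j) f k)%N.
Proof.
by elim: N => [|N IH]; rewrite ?big_ord0// addSn !big_ord_recr /= leq_add2r.
Qed.

Lemma leq_sum_ord (f : nat -> nat) (m n : nat) : (m <= n)%N ->
  (\sum_(k < m) f k <= \sum_(k < n) f k)%N.
Proof. by move=> mn; rewrite -(subnKC mn) big_split_ord leq_addr. Qed.

Lemma sum_unshift (f : nat -> nat) (N j : nat) :
  (\sum_(k < N) (if (j <= k)%N then f (k - j) else 0) <= \sum_(k < N) f k)%N.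
Proof.
apply: (@leq_trans (\sum_(k < N - j) f k)%N); last exact/leq_sum_ord/leq_subr.
elim: N => [|N IH]; first by rewrite big_ord0.
rewrite big_ord_recr /=; case: (leqP j N) => jN.
  by rewrite subSn// big_ord_recr /= leq_add2r.
rewrite addn0; apply: leq_trans IH _.
by rewrite (_ : N - j = 0)%N ?big_ord0//; lia.
Qed.

Lemma limn_esup_le (R : realType) (u : nat -> \bar R) (a : \bar R) (N : nat) :
  (forall n, (N <= n)%N -> (u n <= a)%E) -> (limn_esup u <= a)%E.
Proof.
move=> ua; rewrite /limn_esup /limf_esup.
apply: le_trans (_ : ereal_sup (u @` [set n | (N <= n)%N]) <= _)%E.
  by apply: ereal_inf_lbound; exists [set n | (N <= n)%N] => //; exists N.
by apply: ge_ereal_sup => _ [n /ua + <-].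
Qed.

Section average_shadowing.
Context (R : realType) (rho : cantor_space -> cantor_space -> R).
Context (rhoP : compatible_metric YY rho).

(* The orbits agree on the rest of the block because [left_shift (x m)] and
   [x m.+1] agree on a whole block length at every non-error [m]. *)
Lemma splice_agree (x : nat -> cantor_space) (n0 G M P n : nat) :
  (n %% P + M < P - G)%N ->
  (forall i, (i < M)%N -> ~ hole n0 (fun=> 0) (n + i)) ->
  (forall j, (0 < j < P)%N -> (j <= n)%N ->
    agree P (left_shift (x (n - j)%N)) (x (n - j).+1)) ->
  agree M (iter n left_shift
    (erase n0 (fun=> 0) (splice (P - G) P (fun k => x (k * P)%N)))) (x n).
Proof.
set k := (n %/ P)%N; set j := (n %% P)%N => jM nh ag i iM.
have n_kj : n = (k * P + j)%N by exact: divn_eq.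
rewrite iter_left_shift addnC /erase.
have -> : `[< hole n0 (fun=> 0) (n + i) >] = false by apply/asboolP/nh.
rewrite andbT /splice {2 3 4}n_kj -addnA modnMDl modn_small; last lia.
rewrite divnMDl ?divn_small; try lia.
have -> : (j + i < P - G)%N by lia.
rewrite addn0 /=.
have orbit j' : (j' <= j)%N -> forall i', (j' + i' < P)%N ->
    x (k * P + j')%N i' = x (k * P)%N (j' + i')%N.
  elim: j' => [|j' IH] jj' i' iP; first by rewrite addn0.
  have := ag (j - j')%N; rewrite (_ : n - (j - j') = k * P + j')%N; last lia.
  move=> ag'; rewrite addnS ag' ?/left_shift; try lia.
  by rewrite IH; [congr (x _ _)|..]; lia.
by rewrite {1}n_kj orbit//; lia.
Qed.

(** The shadowing point copies [P - G] symbols from every [P]-th point of the pseudo-orbit and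
    erases the levels above [n0]. A time is bad near the end of a block, shortly before a hole, or
    soon after an error of the pseudo-orbit. A good time costs at most [eps / 4]; bad times cost at
    most [B] and are rare. *)
Lemma average_shadowing_YY : average_shadowing YY left_shift rho.
Proof.
move=> eps eps0; have [B B0 rhoB] := rho_bounded rhoP.
have e40 : 0 < eps / 4 by lra.
have [M MP] := rho_small rhoP e40.
(* Each of the three kinds of bad times will have frequency at most [1 / Q], so together they cost
   at most [3 B / Q <= eps / 4]. *)
pose Q := (Num.bound (12 * B / eps)).+1.
have Q_large : 12 * B <= eps * Q%:R.
  rewrite [leRHS]mulrC -ler_pdivrMr//.
  apply: ltW; apply: lt_le_trans (archi_boundP _) _; last by rewrite ler_nat.
  by apply: divr_ge0; lra.
(* [n0] makes the windows of length [M] that meet a hole rare, [G] is the gap needed by the levels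
   up to [n0], and [P] makes the block ends a fraction [1 / Q] of all times. *)
pose n0 := (M * Q)%N; pose G := ((10 ^ n0).+1 ^ 2)%N; pose P := (Q * (G + M.+1))%N.
have G0 : (0 < G)%N by rewrite expn_gt0.
have GMP : (G + M < P)%N by rewrite /P; nia.
have [eta eta0 etaP] := rho_agree rhoP P.
(* An error costs at least [eta], so errors have frequency at most [1 / (Q P)]; each one spoils at
   most [P] times. *)
exists (eta / (Q * P)%:R).
  by rewrite divr_gt0// ltr0n muln_gt0 /=; lia.
move=> x Yx [N0 N00 xP].
pose z := erase n0 (fun=> 0) (splice (P - G) P (fun k => x (k * P)%N)).
have Yz : YY z.
  rewrite /z -{2}(@subnK G P); last lia.
  by apply: splice_YY.
exists z => //.
apply: (@le_lt_trans _ _ (eps / 2)%:E); last by rewrite lte_fin; lra.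
(* [N > M] lets the boundary term in [N + M] be absorbed in the count of holes. *)
apply: (@limn_esup_le _ _ _ (maxn M N0).+1) => N; rewrite gtn_max => /andP[MN N0N].
rewrite lee_fin.
have N_gt0 : 0 < N%:R :> R by rewrite ltr0n; lia.
pose err m := eta <= rho (left_shift (x m)) (x m.+1).
have Yrho_ge0 y y' : YY y -> YY y' -> 0 <= rho y y' by case: rhoP => + _ _ _ _; apply.
have YSx m : YY (left_shift (x m)) by exact: (@YY_shift (x m) 1).
have err_rare : (Q * P * \sum_(m < N) err m <= N)%N.
  have := xP N 0 N0N; rewrite /average big_mkord.
  under eq_bigr do rewrite addn0.
  move=> avg; have {avg} : \sum_(m < N) rho (left_shift (x m)) (x m.+1) <
      eta / (Q * P)%:R * N%:R by rewrite -ltr_pdivrMr.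
  have : eta * (\sum_(m < N) err m)%:R <=
      \sum_(m < N) rho (left_shift (x m)) (x m.+1).
    rewrite natr_sum mulr_sumr; apply: ler_sum => m _.
    case: (boolP (err m)) => h /=; first by rewrite mulr1.
    by rewrite mulr0n mulr0; exact: Yrho_ge0.
  move=> h1 h2; have := le_lt_trans h1 h2.
  have QP0 : 0 < (Q * P)%:R :> R by rewrite ltr0n muln_gt0 /=; lia.
  rewrite mulrAC ltr_pdivlMr// -mulrA ltr_pM2l// -natrM ltr_nat mulnC.
  exact: ltnW.
pose bad1 n := (P - (G + M.+1) <= n %% P)%N.
(* Causes are counted with multiplicity, so that exchanging the sums bounds their total. *)
pose bad2 n := (\sum_(i < M) `[< hole n0 (fun=> 0) (n + i) >])%N.
pose bad3 n := (\sum_(j < P) (if (j <= n)%N then (err (n - j)%N : nat) else 0))%N.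
pose bad n := (bad1 n + bad2 n + bad3 n)%N.
have bad1_rare : (Q * \sum_(n < N) bad1 n <= N)%N.
  have := @count_mod P (G + M.+1) N; rewrite {3}/P mulnAC.
  rewrite leq_pmul2r; last by rewrite addnS.
  by apply; rewrite /P; nia.
have bad2_rare : (Q * \sum_(n < N) bad2 n <= N)%N.
  rewrite exchange_big /=.
  set S := (\sum_(k < N + M) `[< hole n0 (fun=> 0) k >])%N.
  have S_le : (4 * 5 ^ n0 * S <= N + M)%N by exact: hole_density.
  apply: (@leq_trans (Q * (M * S))%N).
    rewrite leq_mul2l; apply/orP; right.
    apply: (@leq_trans (\sum_(j < M) S)%N); last by rewrite sum_nat_const card_ord.
    apply: leq_sum => i _.
    apply: leq_trans (sum_shift (fun k => `[< hole n0 (fun=> 0) k >] : nat) N i) _.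
    by apply: (leq_sum_ord (fun k => `[< hole n0 (fun=> 0) k >] : nat));
      rewrite leq_add2l ltnW.
  have : (M * Q < 5 ^ n0)%N by rewrite -/n0; exact: ltn_expl.
  by move: S_le; move: (5 ^ n0)%N => W; nia.
have bad3_rare : (Q * \sum_(n < N) bad3 n <= N)%N.
  rewrite exchange_big /=; apply: leq_trans err_rare.
  rewrite -mulnA leq_mul2l; apply/orP; right.
  apply: (@leq_trans (\sum_(j < P) \sum_(m < N) err m)%N).
    by apply: leq_sum => j _; exact: (sum_unshift (fun m => err m : nat)).
  by rewrite sum_nat_const card_ord.
have bad_rare : (Q * \sum_(n < N) bad n <= 3 * N)%N.
  by rewrite /bad !big_split /= !mulnDr (_ : 3 * N = N + N + N)%N ?leq_add//; lia.
have rho_le n : rho (iter n left_shift z) (x n) <= eps / 4 + B * (bad n)%:R.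
  have Yzn : YY (iter n left_shift z) by exact: YY_shift.
  case: (posnP (bad n)) => [bad0|bad_gt0]; last first.
    have : 1 <= (bad n)%:R :> R by rewrite ler1n.
    by have := rhoB _ _ Yzn (Yx n); nra.
  rewrite bad0 mulr0 addr0; apply: ltW; apply: MP => //.
  move/eqP: bad0; rewrite /bad !addn_eq0 => /andP[/andP[b1 b2] b3].
  apply: splice_agree.
  - by move: b1; rewrite eqb0 -ltnNge; move: (n %% P)%N => q; lia.
  - move=> i iM h; move: b2; rewrite /bad2 sum_nat_eq0 => /forallP/(_ (Ordinal iM)) /=.
    by case: asboolP.
  - move=> j /andP[_ jP] jn; apply: etaP => //.
    move: b3; rewrite /bad3 sum_nat_eq0 => /forallP/(_ (Ordinal jP)) /=.
    by rewrite jn /err; case: leP.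
rewrite /average ler_pdivrMr// big_mkord.
apply: (@le_trans _ _ (\sum_(n < N) (eps / 4 + B * (bad n)%:R))).
  by apply: ler_sum => n _; exact: rho_le.
rewrite big_split /= sumr_const card_ord -mulr_sumr -natr_sum.
set S := (\sum_(n < N) bad n)%N in bad_rare *.
have {bad_rare} : (Q%:R * S%:R <= 3 * N%:R :> R) by rewrite -!natrM ler_nat.
rewrite -(mulr_natr (eps / 4) N).
have Q0 : 0 < Q%:R :> R by rewrite ltr0n.
move: (N%:R) (S%:R) (Q%:R) N_gt0 Q0 Q_large => n s q n_gt0 q0 qB qs.
have : q * (B * s) <= q * (eps / 4 * n).
  have : B * (q * s) <= B * (3 * n) by rewrite ler_pM2l.
  have : 12 * B * n <= eps * q * n by rewrite ler_pM2r.
  lra.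
rewrite ler_pM2l//; lra.
Qed.

End average_shadowing.

(** * Entropy *)

Lemma limn_esup_ge (R : realType) (u : nat -> \bar R) (a : \bar R) (N : nat) :
  (forall n, (N <= n)%N -> (a <= u n)%E) -> (a <= limn_esup u)%E.
Proof.
move=> au; apply: le_ereal_inf_tmp => _ [V [M _ MV] <-].
apply: le_trans (au (maxn M N) _) _; first exact: leq_maxr.
by apply: ereal_sup_ubound; exists (maxn M N) => //; apply: MV; exact: leq_maxl.
Qed.

Definition set_point (n : nat) (S : {set 'I_n}) : cantor_space :=
  erase 0 (fun=> 0) (fun k => oapp (fun i => i \in S) false (insub k)).

(** At least [3 n / 4] of the first [n] positions are not erased and can be filled freely. Two
    resulting points differ at some [k < n], so their [k]-th shifts differ in the symbol at [0]. *)
Lemma entropy_YY (R : realType) (rho : cantor_space -> cantor_space -> R) :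
  compatible_metric YY rho ->
  (0%:E < topological_entropy YY left_shift rho)%E.
Proof.
move=> rhoP; have [e e0 eP] := rho_agree rhoP 1.
have ln20 : 0 < ln 2 :> R by rewrite ln_gt0// ltr1n.
apply: (@lt_le_trans _ _ (3 / 4 * ln 2 : R)%:E).
  by rewrite lte_fin mulr_gt0// divr_gt0.
(* [rho_agree] gives a distance of at least [e], whereas separation is strict; hence [e / 2]. *)
apply: (@le_trans _ _
  (limn_esup (log_separated_rate YY left_shift rho (e / 2)))); last first.
  by apply: ereal_sup_ubound; exists (e / 2) => //=; rewrite divr_gt0.
apply: (@limn_esup_ge _ _ _ 1) => n n1.
pose A := [set i : 'I_n | ~~ `[< hole 0 (fun=> 0) i >]]%SET.
have A_large : (3 * n <= 4 * #|A|)%N.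
  have := hole_density 0 n; rewrite muln1.
  have <- : (n - \sum_(k < n) `[< hole 0 (fun=> 0) k >] = #|A|)%N.
    have -> : (\sum_(k < n) `[< hole 0 (fun=> 0) k >] = #|~: A|)%N.
      rewrite -sum1_card [RHS]big_mkcond /=; apply: eq_bigr => i _.
      by rewrite !inE negbK; case: asboolP.
    by have := cardsC A; rewrite card_ord; lia.
  by lia.
have set_pointE (S : {set 'I_n}) (i : 'I_n) : set_point S i = (i \in S) && (i \in A).
  by rewrite /set_point /erase valK inE.
have set_point_out (S : {set 'I_n}) k : (n <= k)%N -> set_point S k = false.
  by move=> nk; rewrite /set_point /erase insubF// ltnNge nk.
pose E := [fset set_point S | S in powerset A]%fset.
have card_E : #|` E| = (2 ^ #|A|)%N.
  rewrite card_in_imfset /= -?cardE ?card_powerset// => S T.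
  rewrite !powersetE => /fintype.subsetP SA /fintype.subsetP TA ST.
  apply/setP => i; have := congr1 (fun x : cantor_space => x i) ST.
  by rewrite !set_pointE (andb_idr (SA i)) (andb_idr (TA i)).
apply: (@le_trans _ _ (ln (#|` fset_set [set` E]|%:R : R) / n%:R)%:E); last first.
  apply: ereal_sup_ubound; exists [set` E] => //; split.
  - exact: finite_fset.
  - by move=> _ /imfsetP[S _ ->]; apply: erase_YY => i; case: i.
  - move=> _ _ /imfsetP[S _ ->] /imfsetP[T _ ->] ST.
    have [k ksep] : exists k, set_point S k <> set_point T k.
      by apply: contrapT => /forallNP same; apply: ST; apply/funext => k;
        exact: contrapT (same k).
    have kn : (k < n)%N.
      by rewrite ltnNge; apply/negP => nk; apply: ksep; rewrite !set_point_out.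
    exists k => //.
    apply: (@lt_le_trans _ _ e); first by lra.
    have Y0 U : YY (iter k left_shift (@set_point n U)).
      by apply: YY_shift; apply: erase_YY => i; case: i.
    rewrite leNgt; apply/negP => small; apply: ksep.
    have := eP _ _ (Y0 S) (Y0 T) small 0%N isT.
    by rewrite !iter_left_shift !add0n.
rewrite lee_fin set_fsetK card_E natrX lnXn// ler_pdivlMr ?ltr0n// -mulr_natr.
rewrite -(mulr_natr (ln 2) #|A|).
have : 3 * n%:R <= 4 * #|A|%:R :> R by rewrite -!natrM ler_nat.
by nra.
Qed.

(** * Measures on the Cantor space *)

(** On the Cantor space these are the clopen sets. *)
Definition determined (A : set cantor_space) : Prop :=
  exists K, forall x y, agree K x y -> A x -> A y.

Lemma agree_sym (K : nat) (x y : cantor_space) : agree K x y -> agree K y x.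
Proof. by move=> xy k kK; rewrite xy. Qed.

Lemma determined0 : determined set0.
Proof. by exists 0. Qed.

Lemma determinedC (A : set cantor_space) : determined A -> determined (~` A).
Proof.
move=> [K AK]; exists K => x y xy nAx Ay; apply: nAx.
by apply: AK Ay; exact: agree_sym.
Qed.

Lemma determinedU (A B : set cantor_space) :
  determined A -> determined B -> determined (A `|` B).
Proof.
move=> [K AK] [M BM]; exists (maxn K M) => x y xy [Ax|Bx]; [left|right].
- by apply: AK Ax; apply: agree_le xy; exact: leq_maxl.
- by apply: BM Bx; apply: agree_le xy; exact: leq_maxr.
Qed.

Lemma determined_agree (K : nat) (x : cantor_space) : determined (agree K x).
Proof. by exists K => y z yz xy k kK; rewrite yz ?xy. Qed.

Lemma determined_open (A : set cantor_space) : determined A -> open A.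
Proof.
move=> [K AK]; rewrite openE => x Ax; apply/nbhs_cylinder; exists K => y xy.
exact: AK xy Ax.
Qed.

Lemma open_bigcup_determined (U : set cantor_space) : open U ->
  U = \bigcup_K [set x | agree K x `<=` U].
Proof.
move=> oU; apply/seteqP; split=> x; last by move=> [K _]; apply.
by move=> Ux; have [K KU] := open_cylinder oU Ux; exists K.
Qed.

(** A copy of the space whose measurable sets are the determined ones, on which Carathéodory's
    extension starts. *)
Definition cylinder_algebra : Type := cantor_space.
HB.instance Definition _ := Pointed.on cylinder_algebra.
HB.instance Definition _ := isAlgebraOfSets.Build default_measure_display
  cylinder_algebra determined0 determinedU determinedC.

Lemma measurable_borel_cantor :
  @measurable _ borel_cantor = <<s determined >>.
Proof.
apply/seteqP; split; last first.
  by apply: sub_smallest2r; [exact: smallest_sigma_algebra|exact: determined_open].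
apply: smallest_sub; first exact: smallest_sigma_algebra.
move=> U /open_bigcup_determined ->.
apply: (@bigcupT_measurable _ (g_sigma_algebraType determined)) => K.
apply: sub_sigma_algebra; exists K => x y xy xU z yz; apply: xU => k kK.
by rewrite yz ?xy.
Qed.

Lemma determined_measurable (A : set cantor_space) :
  determined A -> @measurable _ borel_cantor A.
Proof.
by rewrite measurable_borel_cantor => dA; exact: sub_sigma_algebra.
Qed.

(** Points of the union escaping all finite unions would cluster at a point of some [F i], and then
    one of late index would lie in [F i]. Hence finite additivity on determined sets already implies
    sigma-additivity. *)
Lemma bigcup_determined (F : nat -> set cantor_space) :
  (forall i, determined (F i)) -> determined (\bigcup_i F i) ->
  exists n, \bigcup_i F i `<=` \bigcup_(i < n) F i.
Proof.
move=> dF [K UK]; apply: contrapT => /forallNP bad.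
have /choice[u uP] : forall n, exists x : cantor_space,
    (\bigcup_i F i) x /\ ~ (\bigcup_(i < n) F i) x.
  by move=> n; have /existsNP[x /not_implyP xP] := bad n; exists x.
have [x xP] := sequence_cluster (fun n k => u n k).
have [i _ Fix] : (\bigcup_i F i) x.
  have [n _ xn] := xP K 0; apply: UK (uP n).1.
  exact: agree_sym.
have [M FM] := dF i; have [n ni xn] := xP M i.+1.
by apply: (uP n).2; exists i => //; exact: FM xn Fix.
Qed.

Section extension.
Context (R : realType) (nu : set cantor_space -> R).
Context (nu_ge0 : forall A, 0 <= nu A) (nuT : nu setT = 1).
Context (nuU : forall A B, A `&` B = set0 -> nu (A `|` B) = nu A + nu B).

Let nu0 : nu set0 = 0.
Proof.
by have := @nuU set0 set0; rewrite setI0 setU0 => /(_ erefl); lra.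
Qed.

Let nu_bigU (F : nat -> set cantor_space) (n : nat) : trivIset setT F ->
  nu (\bigcup_(i < n) F i) = \sum_(0 <= i < n) nu (F i).
Proof.
move=> tF; elim: n => [|n IH].
  by rewrite big_geq// bigcup_mkord big_ord0.
rewrite big_nat_recr//= -IH -nuU.
  congr nu; apply/seteqP; split => x.
    move=> [i /=]; rewrite ltnS leq_eqVlt => /orP[/eqP->|ilt] Fx; first by right.
    by left; exists i.
  move=> [[i /= ilt] Fx|Fx]; first by exists i => //=; exact: ltnW.
  by exists n => /=.
rewrite -subset0 => x [[i /= ilt] Fix Fnx].
have := tF i n Logic.I Logic.I; move=> h.
have : i = n by apply: h; exists x.
by move=> e; rewrite e ltnn in ilt.
Qed.

Let cylinder_content (A : set cylinder_algebra) : \bar R := (nu A)%:E.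

Let content0 : cylinder_content set0 = 0%E.
Proof. by rewrite /cylinder_content nu0. Qed.

Let content_ge0 (A : set cylinder_algebra) : (0 <= cylinder_content A)%E.
Proof. by rewrite lee_fin. Qed.

Let content_sigma_additive : semi_sigma_additive cylinder_content.
Proof.
move=> F dF tF dU; have [n nU] := bigcup_determined dF dU.
apply: cvg_near_cst; exists n => // m /= nm.
rewrite /cylinder_content sumEFin -nu_bigU//; congr (nu _)%:E.
apply/seteqP; split=> x; first by move=> [i _ Fx]; exists i.
by move=> /nU[i /= ilt Fx]; exists i => //=; exact: leq_trans nm.
Qed.

HB.instance Definition _ := isMeasure.Build _ _ _ cylinder_content
  content0 content_ge0 content_sigma_additive.

(** Carathéodory's extension lives on the sigma-algebra generated by the determined sets, which is
    the Borel one by [measurable_borel_cantor]. *)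
Lemma cylinder_extension : exists mu : probability borel_cantor R,
  forall A, determined A -> mu A = (nu A)%:E.
Proof.
pose m : set borel_cantor -> \bar R := measure_extension cylinder_content.
have mE A : determined A -> m A = (nu A)%:E.
  by move=> dA; rewrite /m /measure_extension measurable_mu_extE.
have m_sigma : semi_sigma_additive m.
  move=> F; rewrite measurable_borel_cantor => mF tF mU.
  exact: (@measure_semi_sigma_additive _ _ _ (measure_extension cylinder_content)).
have m0 : m set0 = 0%E by rewrite /m measure0.
have m_ge0 A : (0 <= m A)%E by exact: measure_ge0.
pose mM := isMeasure.Build _ borel_cantor R m m0 m_ge0 m_sigma.
have mT : m setT = 1%E.
  by rewrite mE ?nuT//; exists 0.
pose m' : {measure set borel_cantor -> \bar R} := HB.pack m mM.
pose mP := Measure_isProbability.Build _ borel_cantor R m' mT.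
pose mu : probability borel_cantor R := HB.pack (Measure.sort m') mP.
by exists mu.
Qed.

End extension.

(** * A fully supported invariant measure *)

Lemma sum_multiples (f : nat -> nat) (P N : nat) : (0 < P)%N ->
  (\sum_(q < N %/ P) f (P * q) <= \sum_(n < N) f n)%N.
Proof.
move=> P0.
have main Q : (\sum_(q < Q) f (P * q) <= \sum_(n < P * Q) f n)%N.
  elim: Q => [|Q IH]; first by rewrite big_ord0.
  rewrite big_ord_recr mulnSr big_split_ord /= leq_add//.
  by case: P P0 {IH} => // P _; rewrite big_ord_recl /= addn0 leq_addr.
apply: leq_trans (main _) _.
have PN : (P * (N %/ P) <= N)%N by rewrite mulnC leq_divM.
by rewrite -[in X in (_ <= X)%N](subnKC PN) big_split_ord leq_addr.
Qed.

(* The period is a power of 10, so a level [i <= m] erases no symbol in the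
   first [K] positions of a period, and a level [i > m] erases one of these in
   the period number [q] only if the level [i - m] puts a hole at [q]. *)
Lemma recurrent_point (x : cantor_space) (K : nat) : YY x ->
  exists2 y, YY y & exists2 P : nat, (0 < P)%N & forall N,
    (3 * (N %/ P) <=
      4 * \sum_(n < N) `[< agree K x (iter n left_shift y) >])%N.
Proof.
move=> Yx; pose G := ((10 ^ K).+1 ^ 2)%N.
pose m := (K + G)%N; pose P := (10 ^ m)%N.
have P0 : (0 < P)%N by rewrite expn_gt0.
have mP : (2 ^ m + K <= P)%N.
  rewrite /P (_ : 10 = 2 * 5)%N// expnMn.
  have m0 : (0 < m)%N by rewrite /m /G addn_gt0 expn_gt0 orbT.
  have : (5 <= 5 ^ m)%N by rewrite -[X in (X <= _)%N]expn1 leq_exp2l.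
  have : (m < 2 ^ m)%N by exact: ltn_expl.
  by rewrite {1}/m; nia.
have KGP : (K + G <= P)%N by apply/ltnW/ltn_expl.
pose y := erase K (fun=> 0) (splice (P - G) P (fun=> x)).
exists y.
  rewrite /y -{2}(@subnK G P); last lia.
  by apply: splice_YY.
exists P => // N.
have occurs q : ~~ `[< hole 0 (fun=> 0) q >] ->
    `[< agree K x (iter (P * q) left_shift y) >].
  move=> /asboolPn nh; apply/asboolP => k kK.
  rewrite iter_left_shift /y /erase.
  have -> : `[< hole K (fun=> 0) (k + P * q) >] = false.
    apply/asboolP => -[i Ki]; rewrite addn0.
    have ik : (k < 10 ^ i - 2 ^ i)%N.
      have : (2 * 2 ^ i <= 10 ^ i)%N.
        rewrite (_ : 10 = 2 * 5)%N// expnMn mulnC leq_pmul2l ?expn_gt0//.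
        case: i Ki => // i _; rewrite expnS.
        have : (0 < 5 ^ i)%N by rewrite expn_gt0.
        lia.
      have := @ltn_expl 2 i isT; lia.
    case: (leqP i m) => im.
      rewrite /P -(subnK im) expnD mulnAC addnC modnMDl modn_small; last lia.
      by rewrite leqNgt ik.
    pose j := (i - m)%N; have iE : i = (m + j)%N by rewrite /j; lia.
    have i10 : (10 ^ i = P * 10 ^ j)%N by rewrite iE expnD.
    have qj : (q %% 10 ^ j < 10 ^ j)%N by rewrite ltn_pmod// expn_gt0.
    have -> : ((k + P * q) %% 10 ^ i = P * (q %% 10 ^ j) + k)%N.
      rewrite addnC i10 {1}(divn_eq q (10 ^ j)) mulnDr mulnCA -addnA modnMDl.
      by rewrite modn_small//; nia.
    rewrite i10 iE expnD => big; apply: nh; exists j; first by rewrite /j; lia.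
    (* If level [j] had no hole at [q], the position would stay below [P (10^j - 2^j)], hence before
       the last [2^m 2^j] places of the period, as [2^m <= P]. *)
    rewrite addn0 leqNgt; apply/negP => small.
    have j2 : (0 < 2 ^ j)%N by rewrite expn_gt0.
    have j210 : (2 ^ j <= 10 ^ j)%N by rewrite leq_exp2r//; rewrite /j; lia.
    move: small big mP j2 j210 {qj i10 ik KGP}.
    by move: (q %% 10 ^ j)%N (2 ^ j)%N (10 ^ j)%N (2 ^ m)%N => r a b c *; nia.
  rewrite andbT /splice addnC mulnC modnMDl modn_small; last lia.
  by case: ltnP => //; lia.
apply: leq_trans (_ : 4 * \sum_(q < N %/ P) ~~ `[< hole 0 (fun=> 0) q >] <= _)%N.
  have := hole_density 0 (N %/ P); rewrite muln1.
  have : (\sum_(q < N %/ P) ~~ `[< hole 0 (fun=> 0) q >] +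
          \sum_(q < N %/ P) `[< hole 0 (fun=> 0) q >] = N %/ P)%N.
    rewrite -big_split /= -[RHS]card_ord -sum1_card.
    by apply: eq_bigr => q _; case: `[< _ >].
  lia.
rewrite leq_mul2l/=.
apply: leq_trans (sum_multiples
  (fun n => `[< agree K x (iter n left_shift y) >] : nat) N P0).
apply: leq_sum => q _; have := occurs q.
by case: (~~ _) => // ->.
Qed.

(** * Invariant limits along an ultrafilter *)

Lemma ultra_fmap (S T : Type) (f : S -> T) (F : set_system S) :
  UltraFilter F -> UltraFilter (f @ F).
Proof.
move=> FU; split; first exact: fmap_proper_filter.
move=> G GP FG; apply/seteqP; split; last exact: FG.
move=> A GA; have [//|FnA] := in_ultra_setVsetC (f @^-1` A) FU.
have /FG GnA : (f @ F) (~` A) by [].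
by have [? []] := filter_ex (filterI GA GnA).
Qed.

Lemma ultra_lim01 (R : realType) (F : set_system nat) (u : nat -> R) :
  UltraFilter F -> (forall n, 0 <= u n <= 1) -> exists l : R, u @ F --> l.
Proof.
move=> FU u01; have := @segment_compact R 0 1; rewrite compact_ultra.
case/(_ _ (ultra_fmap u FU)); last by move=> l [_ ul]; exists l.
by apply: (@filterS _ F _ setT); [move=> n _; rewrite /= in_itv /= u01|exact: filterT].
Qed.

Lemma determined_shift (A : set cantor_space) :
  determined A -> determined (left_shift @^-1` A).
Proof.
by move=> [K AK]; exists K.+1 => x y xy; apply: AK => k kK; exact: xy.
Qed.

Lemma left_shift_measurable :
  measurable_fun setT (left_shift : borel_cantor -> borel_cantor).
Proof.
apply: (@measurability _ _ borel_cantor borel_cantor setT left_shift determined).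
  exact: measurable_borel_cantor.
by move=> _ [A dA <-]; rewrite setTI; apply: determined_measurable;
  exact: determined_shift.
Qed.

Section invariant.
Context (R : realType) (m : nat -> set cantor_space -> R).
Context (m_ge0 : forall N A, 0 <= m N A) (mT : forall N, m N setT = 1).
Context (mU : forall N A B, A `&` B = set0 -> m N (A `|` B) = m N A + m N B).
Context (m_shift : forall A,
  (fun N => m N (left_shift @^-1` A) - m N A) @ \oo --> (0 : R)).

Let m_le1 N A : m N A <= 1.
Proof.
rewrite -(mT N) -(setUv A) mU ?setICr// lerDl; exact: m_ge0.
Qed.

(** Limits along an ultrafilter preserve positivity, additivity and lower bounds, and make the
    asymptotic invariance exact. *)
Lemma invariant_limit : exists mu : probability borel_cantor R,
  (forall A : set borel_cantor, measurable A ->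
    mu (left_shift @^-1` A) = mu A) /\
  forall A c N0, determined A -> (forall N, (N0 <= N)%N -> c <= m N A) ->
    (c%:E <= mu A)%E.
Proof.
have [U [UU subU]] := ultraFilterLemma (eventually_filter : ProperFilter \oo).
have /choice[nu nuP] : forall A, exists l : R, m ^~ A @ U --> l.
  by move=> A; apply: ultra_lim01 => n; rewrite m_ge0 m_le1.
have nu_ge A c N0 : (forall N, (N0 <= N)%N -> c <= m N A) -> c <= nu A.
  move=> cm; apply: (cvgr_to_ge (nuP A)).
  by apply: subU; exists N0.
have nu_ge0 A : 0 <= nu A by apply: (nu_ge _ _ 0) => N _.
have nuT : nu setT = 1.
  have := nuP setT; rewrite (_ : m ^~ setT = fun=> 1); last exact/funext.
  by move=> h; apply: (cvg_unique _ h) => //; exact: cvg_cst.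
have nuU A B : A `&` B = set0 -> nu (A `|` B) = nu A + nu B.
  move=> AB; have := nuP (A `|` B).
  rewrite (_ : m ^~ _ = fun N => m N A + m N B); last by apply/funext => N; exact: mU.
  by move=> h; apply: (cvg_unique _ h) => //; exact: cvgD.
have nu_shift A : nu (left_shift @^-1` A) = nu A.
  apply/eqP; rewrite -subr_eq0; apply/eqP.
  have h : (fun N => m N (left_shift @^-1` A) - m N A) @ U --> (0 : R).
    by move=> B B0; exact: (subU _ (m_shift _ B0)).
  by apply: (cvg_unique _ _ h) => //; exact: cvgB.
have [mu muE] := cylinder_extension nu_ge0 nuT nuU.
exists mu; split; last by move=> A c N0 dA cA; rewrite muE// lee_fin (nu_ge _ _ N0).
(* [mu] and its image under the shift agree on the determined sets, a generating family closed under
   intersection, so they agree on all Borel sets. *)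
pose X : {mfun borel_cantor >-> borel_cantor} := mfun_Sub (mem_set left_shift_measurable).
move=> A; rewrite measurable_borel_cantor => mA.
apply/esym; apply: (@g_sigma_algebra_measure_unique _ R borel_cantor determined
  _ (fun=> setT) _ _ mu (distribution mu X)) => //.
- by move=> B; exact: determined_measurable.
- by move=> _; exists 0.
- by rewrite bigcup_const//; exists 0.
- move=> B C dB dC; rewrite -[B `&` C]setCK setCI; apply: determinedC.
  by apply: determinedU; exact: determinedC.
- move=> B dB; transitivity (mu (left_shift @^-1` B)); last by [].
  rewrite (muE _ (determined_shift dB)) nu_shift; exact: muE.
- by move=> _; apply: (@le_lt_trans _ _ 1%E); [exact: probability_le1|exact: ltry].
Qed.

End invariant.

(** * Weighted empirical measures *)

Lemma sum_geometric (R : realType) (N : nat) :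
  \sum_(k < N) 2^-1 ^+ k.+1 + 2^-1 ^+ N = 1 :> R.
Proof.
elim: N => [|N IH]; first by rewrite big_ord0 add0r expr0.
by rewrite big_ord_recr /= -[RHS]IH !exprS; lra.
Qed.

Section empirical.
Context (R : realType) (x : nat -> cantor_space).

(** The last weight, at [k = N], collects the tail of the geometric series, so the total is [1]; for
    [k < N] the weight is independent of [N], which makes the bound of [empirical_ge] survive in the
    limit. *)
Definition weight (N k : nat) : R := if (k < N)%N then 2^-1 ^+ k.+1 else 2^-1 ^+ N.

Definition frequency (N : nat) (y : cantor_space) (A : set cantor_space) : R :=
  (\sum_(n < N.+1) `[< A (iter n left_shift y) >])%N%:R / N.+1%:R.

Definition empirical (N : nat) (A : set cantor_space) : R :=
  \sum_(k < N.+1) weight N k * frequency N (x k) A.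

Lemma weight_ge0 (N k : nat) : 0 <= weight N k.
Proof. by rewrite /weight; case: ifP => _; rewrite exprn_ge0// invr_ge0. Qed.

Lemma sum_weight (N : nat) : \sum_(k < N.+1) weight N k = 1.
Proof.
rewrite big_ord_recr /= {2}/weight ltnn -[RHS](sum_geometric R N); congr (_ + _).
by apply: eq_bigr => k _; rewrite /weight ltn_ord.
Qed.

Lemma frequency_ge0 (N : nat) (y : cantor_space) (A : set cantor_space) :
  0 <= frequency N y A.
Proof. by rewrite divr_ge0. Qed.

Lemma frequency1 (N : nat) (y : cantor_space) (A : set cantor_space) :
  (forall n, A (iter n left_shift y)) -> frequency N y A = 1.
Proof.
move=> Ay; rewrite /frequency.
rewrite (eq_bigr (fun=> 1%N)) ?sum_nat_const ?card_ord ?muln1.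
  by rewrite divff// pnatr_eq0.
by move=> n _; rewrite asboolT.
Qed.

Lemma frequencyU (N : nat) (y : cantor_space) (A B : set cantor_space) :
  A `&` B = set0 ->
  frequency N y (A `|` B) = frequency N y A + frequency N y B.
Proof.
move=> AB; rewrite /frequency -mulrDl -natrD -big_split /=.
congr (_%:R / _); apply: eq_bigr => n _; set z := iter n left_shift y.
rewrite asbool_or; case: asboolP => Az; case: asboolP => Bz //.
have : (A `&` B) z by [].
by rewrite AB.
Qed.

(** The two counts differ only in their end terms, at the times [0] and [N.+1]. *)
Lemma frequency_shift (N : nat) (y : cantor_space) (A : set cantor_space) :
  `|frequency N y (left_shift @^-1` A) - frequency N y A| <= N.+1%:R^-1.
Proof.
rewrite /frequency -mulrBl normrM [X in _ * X]ger0_norm ?invr_ge0//.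
rewrite ler_piMl ?invr_ge0//.
pose f n := `[< A (iter n left_shift y) >].
have -> : (\sum_(n < N.+1) `[< (left_shift @^-1` A) (iter n left_shift y) >] =
    \sum_(n < N) f n.+1 + f N.+1)%N by rewrite big_ord_recr.
have -> : (\sum_(n < N.+1) `[< A (iter n left_shift y) >] =
    f 0 + \sum_(n < N) f n.+1)%N by rewrite big_ord_recl.
rewrite !natrD opprD addrACA addrC addrA subrK.
by case: (f N.+1); case: (f 0); rewrite ?subrr ?subr0 ?sub0r ?normrN ?normr0 ?normr1.
Qed.

Lemma empirical_ge0 (N : nat) (A : set cantor_space) : 0 <= empirical N A.
Proof.
by apply: sumr_ge0 => k _; rewrite mulr_ge0 ?weight_ge0 ?frequency_ge0.
Qed.

Lemma empirical1 (N : nat) (A : set cantor_space) :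
  (forall k n, A (iter n left_shift (x k))) -> empirical N A = 1.
Proof.
move=> Ax; rewrite -[RHS](sum_weight N); apply: eq_bigr => k _.
by rewrite frequency1 ?mulr1.
Qed.

Lemma empiricalU (N : nat) (A B : set cantor_space) : A `&` B = set0 ->
  empirical N (A `|` B) = empirical N A + empirical N B.
Proof.
move=> AB; rewrite -big_split /=; apply: eq_bigr => k _.
by rewrite frequencyU// mulrDr.
Qed.

Lemma empirical_shift (A : set cantor_space) :
  (fun N => empirical N (left_shift @^-1` A) - empirical N A) @ \oo --> (0 : R).
Proof.
apply: norm_cvg0; apply: (@squeeze_cvgr _ _ _ _ (fun=> 0) harmonic).
- apply: nearW => N; rewrite normr_ge0 /= /empirical -sumrB.
  apply: le_trans (ler_norm_sum _ _ _) _.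
  have -> : N.+1%:R^-1 = \sum_(k < N.+1) weight N k * N.+1%:R^-1 :> R.
    by rewrite -mulr_suml sum_weight mul1r.
  apply: ler_sum => k _.
  rewrite -mulrBr normrM ger0_norm ?weight_ge0// ler_wpM2l ?weight_ge0//.
  exact: frequency_shift.
- exact: cvg_cst.
- exact: cvg_harmonic.
Qed.

Lemma empirical_ge (k N : nat) (A : set cantor_space) : (k < N)%N ->
  2^-1 ^+ k.+1 * frequency N (x k) A <= empirical N A.
Proof.
move=> kN; rewrite /empirical (bigD1 (Ordinal (ltnW kN : (k < N.+1)%N)))//= /weight kN.
by rewrite lerDl sumr_ge0// => i _; rewrite mulr_ge0 ?weight_ge0 ?frequency_ge0.
Qed.

End empirical.

(** The least set containing [A] that is determined by the first [K] symbols. *)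
Definition cylinder_hull (K : nat) (A : set cantor_space) : set cantor_space :=
  [set x | exists2 y, A y & agree K x y].

Lemma closed_hull (A : set cantor_space) : closed A ->
  ~` A = \bigcup_K ~` cylinder_hull K A.
Proof.
move=> clA; apply/seteqP; split=> x.
  move=> nAx; apply: contrapT => nK; apply: nAx; apply: clA => B /nbhs_cylinder[K KB].
  have [y Ay xy] : cylinder_hull K A x by apply: contrapT => h; apply: nK; exists K.
  by exists y; split => //; exact: KB.
by move=> [K _ nK] Ax; apply: nK; exists x.
Qed.

Lemma fully_supported_YY (R : realType) : exists mu : probability borel_cantor R,
  invariant_measure YY mu /\ fully_supported YY mu.
Proof.
(* The words are enumerated by their codes: [x k] repeats the word of code [k] with positive lower
   density if its cylinder meets [YY], and is any point of [YY] otherwise. *)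
have /choice[x xP] : forall k : nat, exists y, YY y /\ forall w : seq bool,
    choice.unpickle k = Some w -> (exists2 z, YY z & agree (size w) (nth false w) z) ->
    exists2 P : nat, (0 < P)%N & forall N, (3 * (N %/ P) <=
      4 * \sum_(n < N) `[< agree (size w) (nth false w) (iter n left_shift y) >])%N.
  move=> k; case: (pselect (exists w : seq bool, choice.unpickle k = Some w /\
      exists2 z, YY z & agree (size w) (nth false w) z)) => [[w [kw [z Yz wz]]]|now].
    have [y Yy [P P0 yP]] := recurrent_point (size w) Yz.
    exists y; split => // w'; rewrite kw => -[<-] _; exists P => // N.
    apply: leq_trans (yP N) _; rewrite leq_mul2l /=; apply: leq_sum => n _.
    case: asboolP => // zy; rewrite asboolT// => i iw.
    by rewrite zy// wz.
  have [ [y Yy] _ _] := shift_space_YY.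
  by exists y; split => // w kw zw; exfalso; apply: now; exists w.
have Yx k n : YY (iter n left_shift (x k)) by exact: YY_shift (xP k).1.
have [mu [mu_inv mu_ge]] := invariant_limit (@empirical_ge0 R x)
  (fun N => @empirical1 R x N setT (fun _ _ => Logic.I)) (@empiricalU R x)
  (@empirical_shift R x).
have mY : measurable (YY : set borel_cantor).
  rewrite -[YY]setCK; apply: measurableC; apply: sub_sigma_algebra.
  exact/closed_openC/YY_closed.
have muC (A : set cantor_space) : @measurable _ borel_cantor A ->
    mu (~` A) = (1 - mu A)%E.
  by move=> mA; exact: probability_setC.
have hull_determined K : determined (cylinder_hull K YY).
  by exists K => y z yz [t Yt yt]; exists t => // k kK; rewrite yt ?yz.
(* All orbits involved stay in [YY], so each hull of [YY] has empirical measure [1] and its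
   complement is null; these complements cover that of the closed set [YY]. *)
have muCY : mu (~` YY) = 0%E.
  apply: measure_negligible; first exact: measurableC.
  rewrite (closed_hull YY_closed); apply: negligible_bigcup => K.
  apply/negligibleP; first exact: determined_measurable (determinedC (hull_determined K)).
  have mK := determined_measurable (hull_determined K).
  apply: etrans (muC _ mK) _.
  have : (1%:E <= mu (cylinder_hull K YY))%E.
    apply: (mu_ge _ _ 0) => // N _; rewrite empirical1// => k n.
    by exists (iter n left_shift (x k)).
  have := probability_le1 mu mK.
  by move=> h1 h2; rewrite (_ : mu _ = 1%E) ?subee//; apply/eqP; rewrite eq_le h1.
exists mu; split; first split => //.
  by rewrite -[YY]setCK muC ?muCY ?sube0//; exact: measurableC.
move=> U oU [z [Yz Uz]]; have [K zU] := open_cylinder oU Uz.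
pose w := mkseq z K.
have wz : agree K z = agree (size w) (nth false w).
  by apply/funext => y; apply/propext; rewrite /agree size_mkseq; split => h k kK;
    have := h k kK; rewrite nth_mkseq.
have mU : measurable (U : set borel_cantor) by exact: sub_sigma_algebra.
have muYU : mu (YY `&` U) = mu U.
  rewrite -[in RHS](setIT U) -(setUv YY) setIUr measureU//.
  - rewrite (setIC U YY) [X in (_ + X)%E](_ : _ = 0%E) ?adde0//.
    apply/eqP; rewrite eq_le measure_ge0 andbT -muCY.
    apply: le_measure; rewrite ?inE//; [apply: measurableI => //|..]; exact: measurableC.
  - exact: measurableI.
  - by apply: measurableI => //; exact: measurableC.
  - by rewrite setIACA setICr setI0.
rewrite muYU.
have wP : exists2 y, YY y & agree (size w) (nth false w) y.
  by exists z => //; rewrite -wz.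
have [P P0 freq] := (xP (choice.pickle w)).2 w (choice.pickleK w) wP.
(* The weight of the point repeating [w] times a lower bound for the frequency of [w] in it. *)
pose c : R := 2^-1 ^+ (choice.pickle w).+1 * (4 * P)%:R^-1.
have c0 : 0 < c.
  by rewrite mulr_gt0 ?exprn_gt0 ?invr_gt0 ?ltr0n ?muln_gt0.
apply: (@lt_le_trans _ _ c%:E); first by rewrite lte_fin.
apply: (@le_trans _ _ (mu (agree K z))); last first.
  apply: le_measure; rewrite ?inE//.
  exact: determined_measurable (determined_agree K z).
apply: (mu_ge _ _ (maxn P (choice.pickle w).+1)); first exact: determined_agree.
move=> N; rewrite geq_max => /andP[PN wN].
apply: le_trans (@empirical_ge R x _ _ _ wN); rewrite /c ler_wpM2l ?exprn_ge0 ?invr_ge0//.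
rewrite /frequency wz; have := freq N.+1.
set S := (\sum_(n < N.+1) _)%N => PS.
(* With [q = N.+1 %/ P >= 1], one has [N.+1 < (q + 1) P <= 2 q P] and [3 q <= 4 S]. *)
have NP : (N.+1 <= 4 * P * S)%N.
  have : (1 <= N.+1 %/ P)%N by rewrite divn_gt0// leqW.
  have := divn_eq N.+1 P; have := ltn_pmod N.+1 P0.
  by move: (N.+1 %/ P)%N (N.+1 %% P)%N PS => q r; nia.
rewrite ler_pdivlMr ?ltr0n// ler_pdivrMl ?ltr0n ?muln_gt0//.
by rewrite -natrM ler_nat.
Qed.

Theorem theorem27 (R : realType) :
  shift_space YY /\
  mixing YY left_shift /\
  (forall rho : cantor_space -> cantor_space -> R,
     compatible_metric YY rho -> average_shadowing YY left_shift rho) /\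
  (forall rho : cantor_space -> cantor_space -> R,
     compatible_metric YY rho -> (0%:E < topological_entropy YY left_shift rho)%E) /\
  (exists mu : probability borel_cantor R,
     invariant_measure YY mu /\ fully_supported YY mu).
Proof.
split; first exact: shift_space_YY.
split; first exact: mixing_YY.
split; first by move=> rho; exact: average_shadowing_YY.
split; first by move=> rho; exact: entropy_YY.
exact: fully_supported_YY.
Qed.
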